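(* Let $K$ be a number field (viewed inside $\mathbb{C}$) and let $A=\begin{pmatrix}a_{11}&a_{12}\\ a_{21}&a_{22}\end{pmatrix}$ be a $2\times2$ matrix over $K$ such that $A^2\in \mathrm{SL}_2(K)$ (so $\det A=\pm1$). Let $\mathcal{C}(A)=A\circ (A^{-1})^T$ be its combined matrix. In the following, the sign $\pm$ is $+$ if $\det A=1$ and $-$ if $\det A=-1$. Then: 1. $\mathrm{Tr}(\mathcal{C}(A))=\pm 2a_{12}a_{21}+2$. 2. $\det(\mathcal{C}(A))=\mathrm{Tr}(\mathcal{C}(A))-1$. 3. The characteristic polynomial of $\mathcal{C}(A)$ is $p_{\mathcal{C}(A)}(\lambda)=\lambda^2-(\pm2a_{12}a_{21}+2)\lambda\pm2a_{12}a_{21}+1$. 4. The eigenvalues of $\mathcal{C}(A)$ are $\{1,\pm2a_{12}a_{21}+1\}$. 5. The vectors $\begin{pmatrix}1\\1\end{pmatrix},\begin{pmatrix}1\\-1\end{pmatrix}$ form a basis of eigenvectors of $\mathcal{C}(A)$. 6. The Galois group $\mathrm{Gal}(L/K)$ of the characteristic polynomial of $\mathcal{C}(A)$, where $L$ is its splitting field over $K$, is the trivial group. 7. $\mathcal{C}(A)$ is orthogonally diagonalizable: $\mathcal{C}(A)=PDP^T$ with $P=P^T=\dfrac{1}{\sqrt2}\begin{pmatrix}1&1\\1&-1\end{pmatrix}$ and $D=\begin{pmatrix}1&0\\0&\pm2a_{12}a_{21}+1\end{pmatrix}$. Moreover, if $f$ is a function analytic at $1$ and at $\pm2a_{12}a_{21}+1$,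 then $$f(\mathcal{C}(A))=\frac12\begin{pmatrix}1&1\\1&-1\end{pmatrix}\begin{pmatrix}f(1)&0\\0&f(\pm2a_{12}a_{21}+1)\end{pmatrix}\begin{pmatrix}1&1\\1&-1\end{pmatrix}.$$
   Context: A number field is a finite extension of $\mathbb{Q}$. $\circ$ denotes the Hadamard (entrywise) product; the combined matrix of a non-singular matrix $A$ is $\mathcal{C}(A)=A\circ (A^{-1})^T$. The characteristic polynomial of $M$ is $\det(M-\lambda I_n)$. $f(\mathcal{C}(A))$ is the usual matrix function obtained from the holomorphic functional calculus. *)

(* Defs.v *)
From mathcomp Require Export all_boot all_order all_algebra all_fingroup all_field.
From mathcomp Require Export all_classical all_reals all_analysis.
From mathcomp Require Export complex.
Export numFieldNormedType.Exports.

Set Implicit Arguments.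
Unset Strict Implicit.
Unset Printing Implicit Defensive.

Import Order.TTheory GRing.Theory Num.Theory.
Local Open Scope classical_set_scope.
Local Open Scope ring_scope.
Local Open Scope complex_scope.

Definition mat2 (T : Type) (a b c d : T) : 'M[T]_2 :=
  \matrix_(i < 2, j < 2)
    if i == 0 then (if j == 0 then a else b) else (if j == 0 then c else d).

Definition col2 (T : Type) (a b : T) : 'cV[T]_2 :=
  \col_(i < 2) if i == 0 then a else b.

Definition hadamard (F : pzRingType) m n (A B : 'M[F]_(m, n)) : 'M[F]_(m, n) :=
  map2_mx *%R A B.

Definition combined (F : fieldType) n (A : 'M[F]_n) : 'M[F]_n :=
  hadamard A (invmx A)^T.

(* The convention is det (M - X I); the library's char_poly is det (X I - M). *)
Definition charpoly (F : fieldType) n (M : 'M[F]_n) : {poly F} :=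
  \det (map_mx polyC M - 'X%:M).

(* Column eigenvectors; the library's eigenspace consists of row vectors. *)
Definition eigenpair (F : fieldType) n (M : 'M[F]_n) (a : F) (v : 'cV[F]_n) :=
  v != 0 /\ M *m v = a *: v.

Definition spectrum (F : fieldType) n (M : 'M[F]_n) : set F :=
  [set a | exists v, eigenpair M a v].

Definition analytic_at (F : numFieldType) (f : F -> F) (a : F) :=
  exists c : nat -> F,
    \forall z \near a, [series c k * (z - a) ^+ k]_k @ \oo --> f z.

Section FunctionalCalculus.
Variable R : realType.

Definition Cintegral (D : set R) (g : R -> R[i]) : R[i] :=
  Rintegral lebesgue_measure D (fun t => complex.Re (g t)) +i*
  Rintegral lebesgue_measure D (fun t => complex.Im (g t)).

(* Integral of g over the positively oriented circle of centre a and radius r,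
   parametrized by t |-> a + r (cos t + i sin t) on [0, 2 pi]. *)
Definition circle_integral (g : R[i] -> R[i]) (a : R[i]) (r : R) : R[i] :=
  Cintegral `[0, 2 * pi] (fun t =>
    g (a + r%:C * (cos t +i* sin t)) * (r%:C * ((- sin t) +i* cos t))).

(* (2 i pi)^-1 times the integral of f(z) (z I - M)^-1 over the union of the
   positively oriented circles of radius r centred at the eigenvalues of M. *)
Definition cauchy_mx (f : R[i] -> R[i]) n (M : 'M[R[i]]_n) (r : R) :
    'M[R[i]]_n :=
  \matrix_(j, k) ((0 +i* (2 * pi))^-1 *
    \sum_(a \in spectrum M)
       circle_integral (fun z => f z * invmx (z%:M - M) j k) a r).

(* X = f(M) in the sense of the holomorphic functional calculus. A contour
   surrounding the spectrum and lying, with its interior, in the domain of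
   holomorphy of f is made of sufficiently small circles around the
   eigenvalues; for f analytic at each eigenvalue the integral does not depend
   on the (small) radius, and X is unique since the filter 0^'+ is proper. *)
Definition is_matrix_function (f : R[i] -> R[i]) n (M X : 'M[R[i]]_n) :=
  \forall r \near (0 : R)^'+, cauchy_mx f M r = X.

End FunctionalCalculus.

(* Main.v *)
(* With h = det A * a12 * a21, the relation det A ^ 2 = 1 gives
     C(A) = [[1 + h, - h], [- h, 1 + h]],
   so (1, 1) and (1, -1) are eigenvectors, with eigenvalues 1 and 2h + 1 in K.

   For the functional calculus, every entry of (z - C(A))^-1 is
   (1 / (z - 1) +- 1 / (z - (2h + 1))) / 2.  On a small circle z = a + w,
   w = r e^(it), around an eigenvalue a, the integrand f(z) (z - C(A))^-1 dz/dt
   is 'i times a pointwise limit of uniformly bounded polynomials in w, obtained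
   from the power series of f and the geometric series of the other pole.  The
   mean of a polynomial over the circle is its value at w = 0, and dominated
   convergence carries this to the limit, which gives the residue at a. *)
Require Import Defs.
From mathcomp Require Import measurable_realfun ring lra.

Set Implicit Arguments.
Unset Strict Implicit.
Unset Printing Implicit Defensive.

Import Order.TTheory GRing.Theory Num.Theory.
Local Open Scope classical_set_scope.
Local Open Scope ring_scope.
Local Open Scope complex_scope.

(** * Entrywise calculus of 2 by 2 matrices *)

Lemma ord2P (P : 'I_2 -> Prop) : P 0 -> P 1 -> forall i, P i.
Proof.
move=> P0 P1 i; have [->|->] // : i = 0 \/ i = 1.
by case: i => [[|[|//]] ?]; [left|right]; apply: val_inj.
Qed.

Lemma mat2P (T : Type) (B C : 'M[T]_2) :
  B 0 0 = C 0 0 -> B 0 1 = C 0 1 -> B 1 0 = C 1 0 -> B 1 1 = C 1 1 -> B = C.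
Proof. by move=> *; apply/matrixP; elim/ord2P; elim/ord2P. Qed.

Lemma col2P (T : Type) (v w : 'cV[T]_2) :
  v 0 0 = w 0 0 -> v 1 0 = w 1 0 -> v = w.
Proof. by move=> *; apply/matrixP => i j; rewrite (ord1 j); elim/ord2P: i. Qed.

Lemma mulmx2E (F : pzRingType) m n (B : 'M[F]_(m, 2)) (C : 'M[F]_(2, n)) i j :
  (B *m C) i j = B i 0 * C 0 j + B i 1 * C 1 j.
Proof.
rewrite mxE big_ord_recl big_ord1; congr (_ + B _ _ * C _ _); exact: val_inj.
Qed.

Lemma mul_mat2 (F : pzRingType) (a b c d a' b' c' d' : F) :
  mat2 a b c d *m mat2 a' b' c' d' =
  mat2 (a * a' + b * c') (a * b' + b * d') (c * a' + d * c') (c * b' + d * d').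
Proof. by apply: mat2P; rewrite mulmx2E !mxE. Qed.

Lemma scale_mat2 (F : pzRingType) (k a b c d : F) :
  k *: mat2 a b c d = mat2 (k * a) (k * b) (k * c) (k * d).
Proof. by apply: mat2P; rewrite !mxE. Qed.

Lemma mat2_eta (T : Type) (B : 'M[T]_2) :
  B = mat2 (B 0 0) (B 0 1) (B 1 0) (B 1 1).
Proof. by apply: mat2P; rewrite !mxE. Qed.

Lemma det_mx22 (F : comPzRingType) (B : 'M[F]_2) :
  \det B = B 0 0 * B 1 1 - B 0 1 * B 1 0.
Proof.
rewrite (expand_det_row _ 0) big_ord_recl big_ord1 /cofactor !det_mx11 !mxE /=.
rewrite expr0 expr1 mul1r mulN1r mulrN.
by congr (B _ _ * B _ _ - B _ _ * B _ _); exact: val_inj.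
Qed.

Lemma det_mat2 (F : comPzRingType) (a b c d : F) :
  \det (mat2 a b c d) = a * d - b * c.
Proof. by rewrite det_mx22 !mxE. Qed.

Lemma scalar_mat2 (F : pzRingType) (a : F) : a%:M = mat2 a 0 0 a.
Proof. by apply: mat2P; rewrite !mxE. Qed.

Lemma mulmx1_invmx (F : comUnitRingType) n (B C : 'M[F]_n) :
  B *m C = 1%:M -> invmx B = C.
Proof.
move=> BC; have [uB _] := mulmx1_unit BC.
by rewrite -[LHS]mulmx1 -BC mulmxA mulVmx // mul1mx.
Qed.

(** As [e] is its own inverse, the inverse of [B] is [e] times the adjugate. The diagonal entries
    come from [B 0 0 * B 1 1 = e + B 0 1 * B 1 0], multiplied by [e]. *)
Lemma combined_mat2 (F : fieldType) (B : 'M[F]_2) (e : F) :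
  \det B = e -> e ^+ 2 = 1 ->
  let h := e * B 0 1 * B 1 0 in combined B = mat2 (1 + h) (- h) (- h) (1 + h).
Proof.
rewrite det_mx22 => dB e2 h.
rewrite /combined
  (mulmx1_invmx (C := e *: mat2 (B 1 1) (- B 0 1) (- B 1 0) (B 0 0))).
  by apply: mat2P; rewrite !mxE /= /h -?e2 -?dB; ring.
rewrite {1}(mat2_eta B) scale_mat2 mul_mat2 scalar_mat2.
by apply: mat2P; rewrite !mxE /= -?e2 -?dB; ring.
Qed.

(** * Eigenvalues and resolvent of the symmetric matrix [N] *)

Section SymmetricMatrix.
Variables (F : fieldType) (h : F).
Let N := mat2 (1 + h) (- h) (- h) (1 + h).

Lemma charpoly_sym : charpoly N = ('X - 1) * ('X - (2 * h + 1)%:P).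
Proof.
rewrite /charpoly det_mx22 !mxE /= !mulr1n !mulr0n.
ring.
Qed.

Lemma eigenpair_sym1 : eigenpair N 1 (col2 1 1).
Proof.
split; first by apply/eqP => /matrixP/(_ 0 0); rewrite !mxE; apply/eqP/oner_neq0.
by apply: col2P; rewrite mulmx2E !mxE /=; ring.
Qed.

Lemma eigenpair_symN1 : eigenpair N (2 * h + 1) (col2 1 (-1)).
Proof.
split; first by apply/eqP => /matrixP/(_ 0 0); rewrite !mxE; apply/eqP/oner_neq0.
by apply: col2P; rewrite mulmx2E !mxE /=; ring.
Qed.

Lemma spectrum_sym : spectrum N = [set 1; 2 * h + 1].
Proof.
apply/seteqP; split => [a [v [v0 Nv]]|a] /=; last first.
  by case=> ->; [exists (col2 1 1); exact: eigenpair_sym1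
                |exists (col2 1 (-1)); exact: eigenpair_symN1].
have /(congr1 (fun w : 'cV_2 => w 0 0)) := Nv; rewrite mulmx2E !mxE /= => E0.
have /(congr1 (fun w : 'cV_2 => w 1 0)) := Nv; rewrite mulmx2E !mxE /= => E1.
have [->|a1] := eqVneq a 1; [by left|right; apply/eqP].
have [//|ab] := eqVneq a (2 * h + 1); case/eqP: v0.
(* Adding the two rows of [N *m v = a *: v] isolates the factor [a - 1]; once the entries of [v] are
   opposite, the second row alone gives the other factor. Nothing is divided by 2, so characteristic
   2 is covered. *)
have /eqP : (a - 1) * (v 0 0 + v 1 0) = 0 by rewrite mulrDr !mulrBl -E0 -E1; ring.
rewrite mulf_eq0 subr_eq0 (negPf a1) addr_eq0 => /eqP v01.
have /eqP : (a - (2 * h + 1)) * v 1 0 = 0 by rewrite mulrBl -E1 v01; ring.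
rewrite mulf_eq0 subr_eq0 (negPf ab) => /eqP v1.
by apply: col2P; rewrite ?v01 v1 !mxE ?oppr0.
Qed.


(** The resolvent acts by [(z - 1)^-1] on the line of (1, 1) and by [(z - (2 * h + 1))^-1] on that
    of (1, -1). The first projector has all entries 1/2; the second has 1/2 on the diagonal and -1/2
    off it. *)
Lemma invmx_sym (z : F) (j k : 'I_2) :
  2 != 0 :> F -> z != 1 -> z != 2 * h + 1 ->
  invmx (z%:M - N) j k =
    2^-1 * ((z - 1)^-1 + (if j == k then 1 else -1) * (z - (2 * h + 1))^-1).
Proof.
move=> n2; rewrite -subr_eq0 => z1; rewrite -subr_eq0 => zm.
pose u := 2^-1 * ((z - 1)^-1 + (z - (2 * h + 1))^-1).
pose v := 2^-1 * ((z - 1)^-1 - (z - (2 * h + 1))^-1).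
rewrite (mulmx1_invmx (C := mat2 u v v u)); last first.
  by apply: mat2P; rewrite mulmx2E !mxE /= /u /v; field; rewrite ?n2 ?z1 ?zm.
by elim/ord2P: j; elim/ord2P: k; rewrite mxE /= ?mul1r ?mulN1r.
Qed.

End SymmetricMatrix.

(** * Eigenbasis and Galois group *)

Lemma basis_of_pm1 (F : fieldType) : 2 != 0 :> F ->
  basis_of fullv [:: col2 1 1 : 'cV[F]_2; col2 1 (-1)].
Proof.
(* For two vectors in a plane, only spanning is left to prove. *)
move=> n2; rewrite basisEdim dimvf /= andbT.
apply/subvP => w _.
have -> : w = (2^-1 * (w 0 0 + w 1 0)) *: col2 1 1
            + (2^-1 * (w 0 0 - w 1 0)) *: col2 1 (-1).
  by apply: col2P; rewrite !mxE /=; field.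
by rewrite rpredD ?rpredZ ?memv_span ?inE ?eqxx ?orbT.
Qed.

(** Both roots lie in [F], so adjoining them adds nothing: [L] is the line [1%VS], which every
    automorphism fixes pointwise. *)
Lemma gal_charpoly_sym (F : fieldType) (h : F) (L : splittingFieldType F) :
  splittingFieldFor 1%VS
    (map_poly (in_alg L) (charpoly (mat2 (1 + h) (- h) (- h) (1 + h)))) fullv ->
  'Gal({:L} / 1%AS)%g = 1%g.
Proof.
rewrite charpoly_sym => -[rs Dp genL].
have rs1 : {subset rs <= (1%VS : {vspace L})}.
  move=> x xrs; have : root (\prod_(z <- rs) ('X - z%:P)) x by rewrite root_prod_XsubC.
  rewrite -(eqp_root Dp) rmorphM /= !rmorphB /= rmorph1 map_polyX map_polyC /=.
  rewrite rootM -polyC1 !root_XsubC => /orP[]/eqP->; rewrite ?rpred1 //.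
  by rewrite rpredZ ?rpred1.
have L1 : fullv = 1%VS :> {vspace L}.
  apply/eqP; rewrite eqEsubv subvf andbT -genL; apply/Fadjoin_seqP; split => //.
apply/trivgP/fintype.subsetP => x xG; rewrite inE.
apply/gal_eqP => y _; rewrite gal_id (fixed_gal _ xG) ?subvf //.
by have := memvf y; rewrite L1.
Qed.

(** * Calculus along circles: mean values and dominated convergence *)

Section CircleMean.
Variable R : realType.
Implicit Types (g : R -> R[i]) (t : R).
Local Notation Re := (@complex.Re R).
Local Notation Im := (@complex.Im R).

(* The real and imaginary parts are differentiated separately because the
   topology of R[i] has no structure of normed module over R. *)
Definition path_deriv g t (dg : R[i]) :=
  is_derive t 1 (Re \o g) (Re dg) /\ is_derive t 1 (Im \o g) (Im dg).

Lemma path_deriv_cst (c : R[i]) t : path_deriv (fun=> c) t 0.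
Proof. by split; exact: is_derive_cst. Qed.

Lemma ReD (x y : R[i]) : Re (x + y) = Re x + Re y.
Proof. by case: x y => [a b] [c d]. Qed.

Lemma ReB (x y : R[i]) : Re (x - y) = Re x - Re y.
Proof. by case: x y => [a b] [c d]. Qed.

Lemma ImD (x y : R[i]) : Im (x + y) = Im x + Im y.
Proof. by case: x y => [a b] [c d]. Qed.

Lemma ReM (x y : R[i]) : Re (x * y) = Re x * Re y - Im x * Im y.
Proof. by case: x y => [a b] [c d]. Qed.

Lemma ImM (x y : R[i]) : Im (x * y) = Re x * Im y + Im x * Re y.
Proof. by case: x y => [a b] [c d]. Qed.

Lemma path_derivD g1 g2 t d1 d2 :
  path_deriv g1 t d1 -> path_deriv g2 t d2 ->
  path_deriv (fun u => g1 u + g2 u) t (d1 + d2).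
Proof.
move=> [r1 i1] [r2 i2]; rewrite /path_deriv ReD ImD; split.
- rewrite (_ : _ \o _ = (Re \o g1) + (Re \o g2)); first exact: is_deriveD.
  by apply/funext => u /=; rewrite (ReD,ImD).
- rewrite (_ : _ \o _ = (Im \o g1) + (Im \o g2)); first exact: is_deriveD.
  by apply/funext => u /=; rewrite (ReD,ImD).
Qed.

Lemma path_derivM g1 g2 t d1 d2 :
  path_deriv g1 t d1 -> path_deriv g2 t d2 ->
  path_deriv (fun u => g1 u * g2 u) t (d1 * g2 t + g1 t * d2).
Proof.
move=> [r1 i1] [r2 i2]; split.
- rewrite (_ : _ \o _ = (Re \o g1) * (Re \o g2) - (Im \o g1) * (Im \o g2)).
    apply: is_derive_eq; rewrite (ReD,ImD) !ReM /= /GRing.scale /=; ring.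
  by apply/funext => u /=; rewrite ReM.
- rewrite (_ : _ \o _ = (Re \o g1) * (Im \o g2) + (Im \o g1) * (Re \o g2)).
    apply: is_derive_eq; rewrite (ReD,ImD) !ImM /= /GRing.scale /=; ring.
  by apply/funext => u /=; rewrite ImM.
Qed.

Lemma path_deriv_poly (p : {poly R[i]}) g t dg :
  path_deriv g t dg -> path_deriv (fun u => p.[g u]) t (p^`().[g t] * dg).
Proof.
move=> dg_; elim/poly_ind: p => [|p c IHp].
  rewrite deriv0 horner0 mul0r; under eq_fun do rewrite horner0.
  exact: path_deriv_cst.
under eq_fun do rewrite hornerMXaddC.
rewrite derivMXaddC !hornerE mulrDl addrC -[X in path_deriv _ _ X]addr0.
rewrite [p^`().[_] * _ * _]mulrAC.
apply: path_derivD (path_deriv_cst _ _); exact: path_derivM.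
Qed.

Lemma path_deriv_id t : path_deriv (fun u => u%:C) t 1.
Proof.
split; first exact: is_derive_id.
exact: (is_derive_cst 0).
Qed.

Lemma path_deriv_circle (r t : R) :
  path_deriv (fun u => r%:C * (cos u +i* sin u)) t (r%:C * (- sin t +i* cos t)).
Proof.
have -> : r%:C * (- sin t +i* cos t) =
  0 * (cos t +i* sin t) + r%:C * (- sin t +i* cos t) by rewrite mul0r add0r.
apply: path_derivM; first exact: path_deriv_cst.
by split; [exact: is_derive_cos | exact: is_derive_sin].
Qed.

Lemma path_deriv_continuous g t dg : path_deriv g t dg ->
  {for t, continuous (Re \o g)} /\ {for t, continuous (Im \o g)}.
Proof.
by move=> [[d1 _] [d2 _]]; split; apply/differentiable_continuous/derivable1_diffP.
Qed.

(** The real theorem applies to each part; differentiability on the whole line supplies the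
    one-sided limits at the end points. *)
Lemma Cintegral_FTC2 g dg (a b : R) : a < b ->
  (forall t, path_deriv g t (dg t)) ->
  continuous (Re \o dg) -> continuous (Im \o dg) ->
  Cintegral `[a, b] dg = g b - g a.
Proof.
move=> ab gdg cRe cIm.
have FTC (F f : R -> R) : continuous f -> (forall t, is_derive t 1 F (f t)) ->
    Rintegral lebesgue_measure `[a, b] f = F b - F a.
  move=> cf dF; rewrite /Rintegral (continuous_FTC2 (F := F)) //.
  - exact: continuous_subspaceT.
  - have cF : continuous F.
      by move=> t; apply/differentiable_continuous/derivable1_diffP; case: (dF t).
    split; [by move=> t _; case: (dF t)|exact/cvg_at_right_filter/cF|].
    exact/cvg_at_left_filter/cF.
  - by move=> t _; rewrite derive1E; case: (dF t).
have /= iRe := FTC _ _ cRe (fun t => (gdg t).1).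
have /= iIm := FTC _ _ cIm (fun t => (gdg t).2).
rewrite /Cintegral iRe iIm.
by rewrite /=; case: (g a) (g b) => [? ?] [? ?].
Qed.


Lemma Cintegral_circle_poly (p : {poly R[i]}) (r : R) :
  Cintegral `[0, 2 * pi] (fun t => p.[r%:C * (cos t +i* sin t)]) =
  (2 * pi)%:C * p.[0].
Proof.
pose w t : R[i] := r%:C * (cos t +i* sin t).
(* The coefficient p`_0 / 0 of q is irrelevant: 'X * q^`() = p - p`_0. *)
pose q := \poly_(k < size p) (p`_k / k%:R).
have pq : p = 'X * q^`() + (p`_0)%:P.
  apply/polyP => -[|k]; rewrite coefD coefXM coefC /= ?add0r // addr0.
  rewrite coef_deriv coef_poly; case: ltnP => kp; last by rewrite mul0rn nth_default.
  by rewrite -[RHS]mulr_natr divfK // pnatr_eq0.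
pose g t := (t%:C * p`_0) + (- 'i%C) * q.[w t].
have gdg t : path_deriv g t p.[w t].
  have := path_derivD (path_derivM (path_deriv_id t) (path_deriv_cst p`_0 t))
    (path_derivM (path_deriv_cst (- 'i%C) t)
       (path_deriv_poly q (path_deriv_circle r t))).
  rewrite -/(w t); congr path_deriv; rewrite [in RHS]pq hornerD hornerM hornerX hornerC.
  have -> : - sin t +i* cos t = 'i%C * (cos t +i* sin t).
    by rewrite /GRing.mul /=; congr Complex; ring.
  rewrite /w; have := sqr_i R; rewrite expr2 => ii.
  transitivity (p`_0 - ('i%C * 'i%C) * (q^`().[w t] * (r%:C * (cos t +i* sin t)))).
    by rewrite /w; ring.
  by rewrite ii; ring.
have cp t : {for t, continuous (Re \o (fun t => p.[w t]))} /\
            {for t, continuous (Im \o (fun t => p.[w t]))}.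
  exact: path_deriv_continuous (path_deriv_poly p (path_deriv_circle r t)).
rewrite (Cintegral_FTC2 _ gdg); last 3 first.
- by rewrite mulr_gt0 // pi_gt0.
- by move=> t; have [] := cp t.
- by move=> t; have [] := cp t.
rewrite /g /w mulr_natl cos2pi sin2pi cos0 sin0 horner_coef0.
by rewrite rmorph0 mul0r add0r addrK.
Qed.

(** The constant [B] dominates and is integrable on a compact segment; [g] is measurable as a
    pointwise limit of continuous functions. *)
Lemma Rintegral_dominated_cvg (g_ : nat -> R -> R) (g : R -> R) (B a b : R) :
  (forall n, continuous (g_ n)) -> (forall t, g_ n t @[n --> \oo] --> g t) ->
  (forall n t, `|g_ n t| <= B) ->
  Rintegral lebesgue_measure `[a, b] (g_ n) @[n --> \oo] -->
    Rintegral lebesgue_measure `[a, b] g.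
Proof.
move=> cg gg gB.
have mg n : measurable_fun `[a, b] (g_ n).
  by apply: measurable_funTS; exact: continuous_measurable_fun.
have mgo : measurable_fun `[a, b] g.
  by apply: (measurable_fun_cvg (h := g_)).
have iB : lebesgue_measure.-integrable `[a, b] (EFin \o (fun=> B)).
  apply: continuous_compact_integrable; first exact: segment_compact.
  by apply: continuous_subspaceT => x; exact: cvg_cst.
have [] := @dominated_convergence _ _ R lebesgue_measure `[a, b] _
  (fun n => EFin \o g_ n) (EFin \o g) (EFin \o (fun=> B)).
- exact: measurable_itv.
- by move=> n; apply/measurable_EFinP; exact: mg.
- by apply/measurable_EFinP; exact: mgo.
- by apply: aeW => t _; apply: cvg_EFin; [exact: nearW|exact: gg].
- exact: iB.
- by apply: aeW => t n _; rewrite lee_fin.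
(* Finiteness of the limit integral brings the convergence back from extended reals to reals. *)
- move=> ig _ cv; apply: fine_cvg; rewrite fineK //.
  exact: (integrable_fin_num _ ig).
Qed.

(** Seen as a [numFieldType], [R[i]] carries the topology of its norm, in which the limits below are
    taken. *)
Let C : numFieldType := R[i].

Lemma Re_cvg (u : nat -> C) (l : C) :
  u n @[n --> \oo] --> l -> Re (u n) @[n --> \oo] --> Re l.
Proof.
move=> /cvgrPdist_lt ul; apply/cvgrPdist_lt => e e0.
have /ul : 0 < e%:C by rewrite ltcR.
apply: filterS => n; rewrite -ltcR; apply: le_lt_trans.
by rewrite -ReB; exact: normc_ge_Re.
Qed.

(** Reduces limits and bounds of imaginary parts to those of real parts. *)
Lemma ReNi (z : R[i]) : Re (- 'i%C * z) = Im z.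
Proof. by case: z => a b /=; ring. Qed.

Lemma Im_cvg (u : nat -> C) (l : C) :
  u n @[n --> \oo] --> l -> Im (u n) @[n --> \oo] --> Im l.
Proof.
move=> ul; have : - ('i%C : C) * u n @[n --> \oo] --> - ('i%C : C) * l.
  by apply: cvgM => //; exact: cvg_cst.
by move=> /Re_cvg; under eq_fun do rewrite ReNi; rewrite ReNi.
Qed.

Lemma normc_ge_Im (z : R[i]) : `|Im z|%:C <= `|z|.
Proof.
rewrite -ReNi (le_trans (normc_ge_Re _)) // normrM normrN.
by rewrite complexiE normCi mul1r.
Qed.

(** The norm bounds both parts, so real dominated convergence applies to each; an eventually
    constant sequence of integrals then determines the limit integral. *)
Lemma Cintegral_dominated_cvg (g_ : nat -> R -> C) (g : R -> C) (B : R)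
    (v : R[i]) (a b : R) :
  (forall n, continuous (Re \o g_ n)) -> (forall n, continuous (Im \o g_ n)) ->
  (forall t, g_ n t @[n --> \oo] --> g t) -> (forall n t, `|g_ n t| <= B%:C) ->
  (\forall n \near \oo, Cintegral `[a, b] (g_ n) = v) ->
  Cintegral `[a, b] g = v.
Proof.
move=> cRe cIm gg gB gv.
have gl (w_ : nat -> R) (w l : R) : (\forall n \near \oo, w_ n = l) ->
    w_ n @[n --> \oo] --> w -> w = l.
  move=> wl /(cvg_lim (@Rhausdorff R)) <-.
  exact: (lim_near_cst (@Rhausdorff R)).
have RB n t : `|Re (g_ n t)| <= B by rewrite -lecR (le_trans (normc_ge_Re _)).
have IB n t : `|Im (g_ n t)| <= B by rewrite -lecR (le_trans (normc_ge_Im _)).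
have /gl iRe := @Rintegral_dominated_cvg _ _ _ a b cRe (fun t => Re_cvg (gg t)) RB.
have /gl iIm := @Rintegral_dominated_cvg _ _ _ a b cIm (fun t => Im_cvg (gg t)) IB.
rewrite /Cintegral (iRe (Re v)) ?(iIm (Im v)); first by case: (v).
- by apply: filterS gv => n <-.
- by apply: filterS gv => n <-.
Qed.

(** Carries the mean value property to bounded limits of polynomials. The value at 0 is prescribed
    only eventually because the empty partial sum of a power series is 0. *)
Lemma Cintegral_circle_mean (P : nat -> {poly R[i]}) (g : R -> C) (r B : R)
    (v : R[i]) :
  (forall t, ((P n).[r%:C * (cos t +i* sin t)] : C) @[n --> \oo] --> g t) ->
  (forall n t, `|(P n).[r%:C * (cos t +i* sin t)]| <= B%:C) ->
  (\forall n \near \oo, (P n).[0] = v) ->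
  Cintegral `[0, 2 * pi] g = (2 * pi)%:C * v.
Proof.
move=> Pg PB Pv.
have cP n t := path_deriv_continuous
  (path_deriv_poly (P n) (path_deriv_circle r t)).
apply: (Cintegral_dominated_cvg (B := B)
  (g_ := fun n t => (P n).[r%:C * (cos t +i* sin t)])) => //.
- by move=> n t; have [] := cP n t.
- by move=> n t; have [] := cP n t.
- by apply: filterS Pv => n <-; rewrite Cintegral_circle_poly.
Qed.

Lemma norm_circle (r t : R) : 0 <= r -> `|r%:C * (cos t +i* sin t)| = r%:C.
Proof.
move=> r0; rewrite normrM !normc_def /= cos2Dsin2 sqrtr1 mulr1.
by rewrite expr0n addr0 sqrtr_sqr ger0_norm.
Qed.

End CircleMean.

(** * Bounded pointwise limits of polynomials near 0 *)

Section BoundedPolynomialLimit.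
Variable F : numFieldType.
Implicit Types (g : F -> F) (v : F).

(** A substitute for holomorphy near 0 with value [v] there. It keeps what the mean value argument
    uses, with [B] uniform in both [n] and [w], and is stable under products without any Cauchy
    product of series. *)
Definition poly_limit g v := exists2 P : nat -> {poly F},
  exists B : F, \forall w \near (0 : F),
    ((P n).[w] @[n --> \oo] --> g w) /\ forall n, `|(P n).[w]| <= B
  & \forall n \near \oo, (P n).[0] = v.

Lemma poly_limit_cst v : poly_limit (fun=> v) v.
Proof.
exists (fun=> v%:P); last by apply: nearW => n; rewrite hornerC.
exists `|v|; near=> w; split; last by move=> n; rewrite hornerC.
by under eq_fun do rewrite hornerC; exact: cvg_cst.
Unshelve. all: by end_near. Qed.

Lemma poly_limitD g1 g2 v1 v2 : poly_limit g1 v1 -> poly_limit g2 v2 ->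
  poly_limit (fun w => g1 w + g2 w) (v1 + v2).
Proof.
move=> [P1 [B1 PB1] P1v] [P2 [B2 PB2] P2v].
exists (fun n => P1 n + P2 n).
  exists (B1 + B2); near=> w.
  have [c1 b1] : ((P1 n).[w] @[n --> \oo] --> g1 w) /\ forall n, `|(P1 n).[w]| <= B1.
    by near: w.
  have [c2 b2] : ((P2 n).[w] @[n --> \oo] --> g2 w) /\ forall n, `|(P2 n).[w]| <= B2.
    by near: w.
  split; first by under eq_fun do rewrite hornerD; exact: cvgD.
  by move=> n; rewrite hornerD (le_trans (ler_normD _ _)) // lerD.
by near=> n; rewrite hornerD; congr (_ + _); near: n.
Unshelve. all: by end_near. Qed.

Lemma poly_limitM g1 g2 v1 v2 : poly_limit g1 v1 -> poly_limit g2 v2 ->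
  poly_limit (fun w => g1 w * g2 w) (v1 * v2).
Proof.
move=> [P1 [B1 PB1] P1v] [P2 [B2 PB2] P2v].
exists (fun n => P1 n * P2 n).
  exists (B1 * B2); near=> w.
  have [c1 b1] : ((P1 n).[w] @[n --> \oo] --> g1 w) /\ forall n, `|(P1 n).[w]| <= B1.
    by near: w.
  have [c2 b2] : ((P2 n).[w] @[n --> \oo] --> g2 w) /\ forall n, `|(P2 n).[w]| <= B2.
    by near: w.
  split; first by under eq_fun do rewrite hornerM; exact: cvgM.
  by move=> n; rewrite hornerM normrM ler_pM.
by near=> n; rewrite hornerM; congr (_ * _); near: n.
Unshelve. all: by end_near. Qed.

(** The polynomials are the partial sums. Their uniform bound comes from comparison with a geometric
    series, on a disc smaller than the disc of convergence. *)
Lemma poly_limit_analytic f a : analytic_at f a ->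
  poly_limit (fun w => f (a + w)) (f a).
Proof.
case=> c /nbhs_ballP[e /= e0 ce].
pose P n := \sum_(k < n) (c k)%:P * 'X^k.
have PE n w : (P n).[w] = \sum_(k < n) c k * w ^+ k.
  by rewrite horner_sum; apply: eq_bigr => k _; rewrite hornerM hornerC hornerXn.
have serE w : (fun n => (P n).[w]) = series (fun k => c k * w ^+ k).
  by apply/funext => n; rewrite PE /series /= big_mkord.
have Pcvg w : `|w| < e -> (P n).[w] @[n --> \oo] --> f (a + w).
  move=> we; have /ce : ball a e (a + w).
    by rewrite -ball_normE /ball_ /= opprD addNKr normrN.
  by rewrite (addrC a) addrK serE.
(* The successor matters: [P 0] is the empty sum. *)
have P0 n : (P n.+1).[0] = c 0%N.
  rewrite PE big_ord_recl expr0 mulr1 big1 ?addr0 // => k _.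
  by rewrite expr0n mulr0.
have fa : f a = c 0%N.
  have := @Pcvg 0; rewrite normr0 addr0 => /(_ e0) /(cvg_lim (@norm_hausdorff _ _)) <-.
  apply: (lim_near_cst (@norm_hausdorff _ _)).
  by exists 1%N => // -[|n] // _; exact: P0.
pose q := e / 2.
have q0 : 0 < q by rewrite divr_gt0.
have qe : q < e by rewrite ltr_pdivrMr // ltr_pMr // ltr1n.
(* Convergence at [q] sends the terms to 0: from [N] on they are at most 1 in norm, and the first
   [N] are bounded by their sum. *)
have [M M0 cM] : exists2 M, 0 <= M & forall k, `|c k| * q ^+ k <= M.
  have : cvgn (series (fun k => c k * q ^+ k)).
    apply/cvg_ex; exists (f (a + q)).
    by rewrite -serE; apply: Pcvg; rewrite gtr0_norm.
  move/cvg_series_cvg_0/cvgr0_norm_le/(_ _ ltr01) => [N _ cN].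
  exists (1 + \sum_(k < N) `|c k| * q ^+ k) => [|k].
    by rewrite addr_ge0 ?sumr_ge0 // => k _; rewrite mulr_ge0 // exprn_ge0 // ltW.
  case: (ltnP k N) => [kN|/cN /=]; last first.
    rewrite normrM normrX (gtr0_norm q0) => /le_trans; apply.
    by rewrite lerDl sumr_ge0 // => j _; rewrite mulr_ge0 // exprn_ge0 // ltW.
  rewrite (bigD1 (Ordinal kN)) //= addrCA lerDl addr_ge0 // sumr_ge0 // => j _.
  by rewrite mulr_ge0 // exprn_ge0 // ltW.
exists P; last by exists 1%N => // -[|n] // _; rewrite P0 fa.
(* When [w] has norm below [q / 2], the term of index [k] is at most [M * 2^-1 ^+ k], and these add
   up to at most [M * 2]. *)
exists (M * 2); apply/nbhs_ballP; exists (q / 2); first by rewrite /= divr_gt0.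
move=> w; rewrite -ball_normE /ball_ /= sub0r normrN => wq.
split.
  apply: Pcvg; rewrite (lt_trans wq) // (le_lt_trans _ qe) //.
  by rewrite ler_piMr ?ltW // invf_lt1 ?ltr1n.
move=> n; rewrite PE.
have half k : \sum_(j < k) (2^-1 : F) ^+ j = 2 * (1 - 2^-1 ^+ k).
  elim: k => [|k IHk]; first by rewrite big_ord0 expr0 subrr mulr0.
  by rewrite big_ord_recr /= IHk exprS; field.
apply: (le_trans (ler_norm_sum _ _ _)).
apply: (@le_trans _ _ (\sum_(k < n) M * 2^-1 ^+ k)).
  apply: ler_sum => k _; rewrite normrM normrX.
  apply: (@le_trans _ _ (`|c k| * (q * 2^-1) ^+ k)).
    by rewrite ler_wpM2l // lerXn2r ?nnegrE ?(ltW wq) // ltW // divr_gt0.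
  by rewrite exprMn mulrA ler_wpM2r // exprn_ge0 // invr_ge0.
by rewrite -mulr_sumr half ler_wpM2l // ger_pMr // gerBl exprn_ge0.
Qed.

End BoundedPolynomialLimit.

(** * Residues on small circles *)

Section CircleIntegral.
Variable R : realType.
Let C : numFieldType := R[i].

(** Norms and positive elements of [R[i]] are real, so the claim comes down to the real geometric
    sequence. *)
Lemma cvg_exprC (x : C) : `|x| < 1 -> x ^+ n @[n --> \oo] --> (0 : C).
Proof.
move=> x1; have xR : `|x| = (complex.Re `|x|)%:C :> R[i].
  by rewrite RRe_real // normr_real.
apply/cvgr0Pnorm_lt => e e0.
have eR : e = (complex.Re e)%:C :> R[i] by rewrite RRe_real // gtr0_real.
have e1 : 0 < complex.Re e by rewrite -ltcR -eR.
have x0 : 0 <= complex.Re `|x| by rewrite -lecR -xR normr_ge0.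
have : `|complex.Re `|x| | < 1 by rewrite ger0_norm // -ltcR -xR.
move=> /cvg_expr/cvgr0Pnorm_lt/(_ _ e1); apply: filterS => n.
rewrite normrX ger0_norm // => ne.
by rewrite normrX xR eR -rmorphXn ltcR.
Qed.

(** Geometric series in [z / d], convergent on the disc of radius [|d|]. *)
Lemma analytic_at_inv (d : C) : d != 0 -> analytic_at (fun w => (w - d)^-1) 0.
Proof.
move=> d0; exists (fun k => - d^-1 * d^-1 ^+ k).
apply/nbhs_ballP; exists `|d|; first by rewrite /= normr_gt0.
move=> z; rewrite -ball_normE /ball_ /= sub0r normrN => ltzd.
have zd : `|z / d| < 1 by rewrite normrM normfV ltr_pdivrMr ?normr_gt0 // mul1r.
have zd1 : z / d != 1 by apply/eqP => e; rewrite e normr1 ltxx in zd.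
under eq_fun do rewrite subr0 -mulrA -exprMn [_^-1 * z]mulrC.
rewrite (geometric_seriesE (- d^-1) zd1).
rewrite (_ : (z - d)^-1 = - d^-1 * (1 - 0) / (1 - z / d)); last first.
  field; rewrite d0 -(opprB d z) oppr_eq0 andbb subr_eq0.
  by apply: contraNneq zd1 => <-; rewrite divff.
apply: cvgM; [apply: cvgM; [exact: cvg_cst|] | exact: cvg_cst].
by apply: cvgB; [exact: cvg_cst|exact: cvg_exprC].
Qed.

Lemma near0_circle (P : C -> Prop) : (\forall w \near (0 : C), P w) ->
  \forall r \near (0 : R)^'+, forall t, P (r%:C * (cos t +i* sin t)).
Proof.
move=> /nbhs_ballP[e /= e0 eP].
have eR : e = (complex.Re e)%:C :> R[i] by rewrite RRe_real // gtr0_real.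
have e1 : 0 < complex.Re e by rewrite -ltcR -eR.
near=> r => t; apply: eP; rewrite -ball_normE /ball_ /= sub0r normrN.
rewrite norm_circle // eR ltcR; near: r; exact: nbhs_right_lt.
Unshelve. all: by end_near. Qed.

(** Since [dz/dt = 'i * w], the integrand is ['i] times [g (a + w) * w]. The factor [w] cancels a
    simple pole of [g] at [a], and [h] fills in the value at [w = 0]; circles of positive radius
    stay in the punctured neighbourhood. *)
Lemma circle_integral_poly_limit (g : R[i] -> R[i]) (a : R[i]) (h : C -> C)
    (v : R[i]) :
  poly_limit h v ->
  (\forall w \near (0 : C)^', g (a + w) * w = h w) ->
  \forall r \near (0 : R)^'+, circle_integral g a r = (2 * pi)%:C * ('i%C * v).
Proof.
move=> hv gh.
have [P [B PB] Pv] := poly_limitM (poly_limit_cst ('i%C : C)) hv.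
have /near0_circle PB' := PB.
have /near0_circle gh' : \forall w \near (0 : C), w != 0 -> g (a + w) * w = h w by [].
apply: filterS3 (nbhs_right_gt (0 : R)) PB' gh' => r r0 {}PB' {}gh'.
rewrite /circle_integral.
have -> : (fun t => g (a + r%:C * (cos t +i* sin t)) * (r%:C * (- sin t +i* cos t)))
    = (fun t => 'i%C * h (r%:C * (cos t +i* sin t))).
  apply/funext => t; rewrite -gh' //; last first.
    by rewrite -normr_eq0 norm_circle ?ltW // lt0r_neq0 // ltcR.
  rewrite [RHS]mulrCA; congr (_ * _).
  by rewrite [RHS]mulrCA; congr (_ * _); rewrite /GRing.mul /=; congr Complex; ring.
apply: (Cintegral_circle_mean (P := P) (r := r) (B := complex.Re B)) => //.
- by move=> t; have [] := PB' t.
- move=> n t; have [_ /(_ n) b] := PB' t.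
  by rewrite RRe_real // ger0_real // (le_trans _ b).
Qed.

(** Residue at a simple pole: after multiplication by [w = z - a], the factor of [f] is
    [al + be * w / (w - d)], which equals [al] at [w = 0]. Radii below [|d|] keep the circle off the
    other pole [a + d]. *)
Lemma circle_integral_resolvent (f g : R[i] -> R[i]) (a al be d : R[i]) :
  analytic_at (f : C -> C) a -> d != 0 ->
  (forall z, z != a -> z != a + d ->
     g z = f z * (al * (z - a)^-1 + be * (z - (a + d))^-1)) ->
  \forall r \near (0 : R)^'+,
    circle_integral g a r = (2 * pi)%:C * ('i%C * (al * f a)).
Proof.
move=> fa d0 gE.
have iv : poly_limit (fun w : C => (w - d)^-1) (- d^-1).
  have := poly_limit_analytic (analytic_at_inv d0).
  by under eq_fun do rewrite add0r; rewrite sub0r invrN.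
(* w / (w - d) = 1 + d / (w - d) *)
have hlim := poly_limitM (poly_limit_analytic fa)
  (poly_limitD (poly_limit_cst ((al + be) : C))
     (poly_limitM (poly_limit_cst (be * d : C)) iv)).
(* The right-hand side is the value at [w = 0] in the shape produced by the sum and product
   rules. *)
rewrite (_ : al * f a = f a * (al + be + be * d * - d^-1)); last by field.
apply: circle_integral_poly_limit hlim _.
apply/nbhs_ballP; exists `|d|; first by rewrite /= normr_gt0.
move=> w; rewrite -ball_normE /ball_ /= sub0r normrN => wd w0.
have dw : w != d by apply: contraTneq wd => ->; rewrite ltxx.
rewrite gE; last 2 first.
- by rewrite -subr_eq0 addrAC subrr add0r.
- by rewrite (inj_eq (addrI a)).
by field; rewrite subr_eq0 dw addrAC subrr add0r.
Qed.

End CircleIntegral.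

(** * The functional calculus of [N], as a sum of residues *)

Lemma is_matrix_function_sym (R : realType) (f : R[i] -> R[i]) (h : R[i]) :
  analytic_at f 1 -> analytic_at f (2 * h + 1) ->
  is_matrix_function f (mat2 (1 + h) (- h) (- h) (1 + h))
    (2^-1 *: (mat2 1 1 1 (-1) *m mat2 (f 1) 0 0 (f (2 * h + 1))
                 *m mat2 1 1 1 (-1))).
Proof.
set m := 2 * h + 1; set N := mat2 _ _ _ _ => f1 fm.
have n2 : 2 != 0 :> R[i] by rewrite pnatr_eq0.
pose sg (j k : 'I_2) : R[i] := if j == k then 1 else -1.
have XE (j k : 'I_2) : (2^-1 *: (mat2 1 1 1 (-1) *m mat2 (f 1) 0 0 (f m)
    *m mat2 1 1 1 (-1))) j k = 2^-1 * f 1 + 2^-1 * sg j k * f m.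
  rewrite !mul_mat2 scale_mat2 /sg.
  by elim/ord2P: j; elim/ord2P: k; rewrite mxE /=; ring.
have pi2i : (2 * pi)%:C * 'i%C = 0 +i* (2 * pi) :> R[i].
  by rewrite /GRing.mul /=; congr Complex; ring.
have pi0 : 0 +i* (2 * pi) != 0 :> R[i].
  by rewrite eq_complex /= negb_and orbC mulf_neq0 ?pnatr_eq0 // gt_eqF ?pi_gt0.
(* There are finitely many entries, so radii small enough for each entry are small enough for
   all. *)
suff entry (j k : 'I_2) : \forall r \near (0 : R)^'+, cauchy_mx f N r j k =
    2^-1 * f 1 + 2^-1 * sg j k * f m.
  have : \forall r \near (0 : R)^'+, forall j k,
      cauchy_mx f N r j k = 2^-1 * f 1 + 2^-1 * sg j k * f m.
    by apply: filter_forall => j; apply: filter_forall => k; exact: entry.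
  by apply: filterS => r E; apply/matrixP => j k; rewrite XE.
have [m1|m1] := eqVneq m 1.
(* Double eigenvalue: the two fractions of the resolvent merge and there is a single circle. The
   second pole is a dummy at distance [d = 1] with coefficient [be = 0]. *)
- have E1 := circle_integral_resolvent (al := 2^-1 * (1 + sg j k)) (be := 0)
    (g := fun z => f z * invmx (z%:M - N) j k) f1 (oner_neq0 _).
  apply: filterS (E1 _) => [r {}E1|z z1 _].
    rewrite mxE spectrum_sym -/m m1 setUid fsbig_set1 E1.
    by rewrite mulrA pi2i mulKf //; ring.
  by rewrite invmx_sym -/m ?m1 // -/(sg j k); congr (_ * _); ring.
(* Distinct eigenvalues: two circles, each having the other eigenvalue as its second pole, so the
   roles of [al] and [be] are exchanged. *)
- have sumE (F : R[i] -> R[i]) : \sum_(a \in [set 1; m]) F a = F 1 + F m.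
    rewrite fsbigU0 ?fsbig_set1 // => x [/= -> /eqP].
    by rewrite eq_sym (negPf m1).
  have d1 : m - 1 != 0 by rewrite subr_eq0.
  have d2 : 1 - m != 0 by rewrite subr_eq0 eq_sym.
  have := circle_integral_resolvent (al := 2^-1) (be := 2^-1 * sg j k)
    (g := fun z => f z * invmx (z%:M - N) j k) f1 d1.
  have := circle_integral_resolvent (al := 2^-1 * sg j k) (be := 2^-1)
    (g := fun z => f z * invmx (z%:M - N) j k) fm d2.
  rewrite ![_ + (_ - _)]addrC !subrK => Em E1.
  apply: filterS2 (E1 _) (Em _).
  + move=> r {}E1 {}Em; rewrite mxE spectrum_sym -/m sumE E1 Em.
    by rewrite !(mulrA (2 * pi)%:C) pi2i -mulrDr mulKf //; ring.
  + move=> z z1 zm; rewrite invmx_sym // -/(sg j k); congr (_ * _); ring.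
  + move=> z zm z1; rewrite invmx_sym // -/(sg j k); congr (_ * _); ring.
Qed.

(** The embedding [iota] places the number field inside the complex numbers. The spectrum, the
    orthogonal diagonalization (where the square root of 2 enters) and the functional calculus are
    stated there; the rest is stated over [K]. *)
Theorem proposition2 (R : realType) (K : fieldExtType rat)
    (iota : {rmorphism K -> R[i]}) (A : 'M[K]_2) (hA : \det (A ^+ 2) = 1) :
  let s : K := if \det A == 1 then 1 else -1 in
  let b : K := s * 2 * A 0 1 * A 1 0 in
  let M : 'M[K]_2 := combined A in
  let MC : 'M[R[i]]_2 := map_mx iota M in
  let mu : R[i] := iota (b + 1) in
  [/\ \det A = 1 \/ \det A = -1,
      \tr M = b + 2,
      \det M = \tr M - 1 &
      charpoly M = 'X^2 - (b + 2)%:P * 'X + b%:P + 1]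
  /\ [/\ spectrum MC = [set 1; mu],
         [/\ basis_of fullv [:: col2 1 1 : 'cV[K]_2; col2 1 (-1)],
            exists a, eigenpair M a (col2 1 1) &
            exists a, eigenpair M a (col2 1 (-1))],
         (forall L : splittingFieldType K,
            splittingFieldFor 1%VS (map_poly (in_alg L) (charpoly M)) fullv ->
            'Gal({:L} / 1%AS)%g = 1%g),
         (let P : 'M[R[i]]_2 :=
            ((Num.sqrt 2 : R)%:C)^-1 *: mat2 1 1 1 (-1) in
          [/\ P^T = P, P *m P^T = 1%:M & MC = P *m mat2 1 0 0 mu *m P^T]) &
         (forall f : R[i] -> R[i],
            analytic_at f 1 -> analytic_at f mu ->
            is_matrix_function f MC
              (2^-1 *: (mat2 1 1 1 (-1) *m mat2 (f 1) 0 0 (f mu)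
                          *m mat2 1 1 1 (-1))))].
Proof.
move=> s b M MC mu.
have d2 : \det A ^+ 2 = 1 by rewrite -hA !expr2 -[A * A]/(A *m A) det_mulmx.
have dA : \det A = 1 \/ \det A = -1.
  by have /eqP := d2; rewrite sqrf_eq1 => /orP[]/eqP; [left|right].
(* Read off in characteristic 0 through the injective [iota]. *)
have n2 : 2 != 0 :> K by rewrite -(fmorph_eq0 iota) rmorph_nat pnatr_eq0.
have ds : \det A = s.
  by rewrite /s; case: eqP => // n1; case: dA.
pose h := s * A 0 1 * A 1 0.
have MN : M = mat2 (1 + h) (- h) (- h) (1 + h).
  by rewrite /M (combined_mat2 ds) // -ds.
have bh : b = 2 * h by rewrite /b /h; ring.
(* The shape is preserved by [iota], so the complex statements are the symmetric case with parameter
   [iota h]. *)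
have MCN : MC = mat2 (1 + iota h) (- iota h) (- iota h) (1 + iota h).
  by rewrite /MC MN; apply: mat2P; rewrite !mxE /=; ring.
have muE : mu = 2 * iota h + 1 by rewrite /mu bh; ring.
have trM : \tr M = b + 2.
  rewrite MN bh /mxtrace big_ord_recl big_ord1 !mxE /=; ring.
split; split=> //.
- by rewrite trM MN det_mat2 bh; ring.
- by rewrite MN charpoly_sym bh; ring.
- by rewrite MCN spectrum_sym muE.
- split; first exact: basis_of_pm1.
    by exists 1; rewrite MN; exact: eigenpair_sym1.
  by exists (2 * h + 1); rewrite MN; exact: eigenpair_symN1.
- by move=> L; rewrite MN; exact: gal_charpoly_sym.
- move=> P.
  (* The square root enters the products only through its square. *)
  have P2 : ((Num.sqrt 2 : R)%:C)^-1 * ((Num.sqrt 2 : R)%:C)^-1 = 2^-1 :> R[i].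
    by rewrite -invfM -rmorphM /= -expr2 sqr_sqrtr ?ler0n // rmorph_nat.
  have PT : P^T = P by apply: mat2P; rewrite !mxE.
  have n2C : 2 != 0 :> R[i] by rewrite pnatr_eq0.
  rewrite PT; split => //.
    rewrite /P -scalemxAl -scalemxAr scalerA P2 mul_mat2 scale_mat2 scalar_mat2.
    by congr mat2; field.
  rewrite /P -scalemxAl -scalemxAr -scalemxAl scalerA P2 !mul_mat2 scale_mat2.
  by rewrite MCN muE; congr mat2; field.
- move=> f f1 fmu; rewrite muE in fmu *.
  by rewrite MCN; exact: is_matrix_function_sym.
Qed.
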